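(* Let $p\in\mathbb{Z}_+^n$, let $k=(k_1,\dots,k_s)\in\mathbb{Z}_+^s$ be a partition of $n$, and let $h\in\mathbb{Z}_+^s$ be such that $1\le h_j\le k_j-1$ for all $j=1,\dots,s$. Let $\mathcal{T}_k(p)$ be the maximal connected subgroup of $\mathbb{T}^n$ all of whose elements $\tau$ satisfy $\varphi(\tau z)=\varphi(z)$ for every $\varphi\in\mathcal{A}_{k,h}(\Omega_p^n)$ and every $z\in\Omega_p^n$. Then $\mathcal{T}_k(p)=\pi_p(\mathbb{T}^s_k)$, where $$\mathbb{T}^s_k=\{\tau\in\mathbb{T}^n:\ \exists\,\omega\in\mathbb{T}^s\text{ such that }\tau_{(j)}=(\omega_j,\dots,\omega_j)\ \ \forall\, j=1,\dots,s\}.$$ In particular, $\mathcal{T}_k(p)$ is a closed subgroup of $\mathbb{T}^n$ isomorphic to $\mathbb{T}^s$.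
   Context: $\mathbb{N}=\{0,1,2,\dots\}$, $\mathbb{Z}_+=\{1,2,\dots\}$, $\mathbb{T}$ is the unit circle in $\mathbb{C}$. For $p\in\mathbb{Z}_+^n$, $\Omega_p^n=\{z\in\mathbb{C}^n:\sum_{j=1}^n|z_j|^{2p_j}<1\}$; $\mathbb{T}^n$ acts on it by $\tau z=(\tau_1z_1,\dots,\tau_nz_n)$. A partition of $n$ is $k=(k_1,\dots,k_s)\in\mathbb{Z}_+^s$ with $k_1+\cdots+k_s=n$; put $\widehat{k}_0=0$ and $\widehat{k}_j=\widehat{k}_{j-1}+k_j$. For an $n$-tuple $z$ write $z_{(j)}=(z_{\widehat{k}_{j-1}+1},\dots,z_{\widehat{k}_j})$, with components $(z_{(j)})_1,\dots,(z_{(j)})_{k_j}$. For $z\in\mathbb{C}^n$ let $$r_j=\Big(\sum_{t=\widehat{k}_{j-1}+1}^{\widehat{k}_j}|z_t|^{2p_t}\Big)^{1/2},\qquad \xi_t=z_t\, r_j^{-1/p_t}\ \text{ for } \widehat{k}_{j-1}<t\le\widehat{k}_j,$$ with the convention $\xi_{(j)}=0$ when $r_j=0$. For $\nu,\mu\in\mathbb{N}^n$, $\xi^\nu\overline{\xi}^\mu=\prod_{t=1}^n\xi_t^{\nu_t}\overline{\xi_t}^{\mu_t}$ (with $0^0=1$). A $k$-quasi-radial symbol is a function $a$ on $\Omega_p^n$ of the form $a(z)=\widetilde{a}(r_1,\dots,r_s)$. The set $\mathcal{A}_{k,h}(\Omega_p^n)$ consists of all functions $\varphi=a\,\xi^\nu\overline{\xi}^\mu$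 on $\Omega_p^n$ where $a$ is a bounded measurable $k$-quasi-radial symbol and $\nu,\mu\in\mathbb{N}^n$ satisfy: (i) $\nu\cdot\mu=\sum_{t=1}^n\nu_t\mu_t=0$ and $\displaystyle\sum_{t=\widehat{k}_{j-1}+1}^{\widehat{k}_j}\frac{\nu_t-\mu_t}{p_t}=0$ for all $j=1,\dots,s$; (ii) $(\nu_{(j)})_{t_1}=0$ and $(\mu_{(j)})_{t_2}=0$ for all $1\le t_2\le h_j<t_1\le k_j$ and all $j=1,\dots,s$. Let $\mathrm{lcm}(p)$ be the least common multiple of $p_1,\dots,p_n$ and $\Lambda(p)=\mathrm{lcm}(p)\left(\frac1{p_1},\dots,\frac1{p_n}\right)\in\mathbb{Z}_+^n$. The homomorphism $\pi_p:\mathbb{T}^n\to\mathbb{T}^n$ is $\pi_p(t)=(t_1^{\Lambda(p)_1},\dots,t_n^{\Lambda(p)_n})$. *)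

(* Defs.v *)
From HB Require Import structures.
From mathcomp Require Import all_boot all_order all_algebra.
From mathcomp Require Import all_classical all_reals all_analysis.
From mathcomp Require Import complex.

Set Implicit Arguments.
Unset Strict Implicit.
Unset Printing Implicit Defensive.

Import Order.TTheory GRing.Theory Num.Theory.
Import numFieldNormedType.Exports.

Local Open Scope classical_set_scope.
Local Open Scope ring_scope.
Local Open Scope complex_scope.

(* The usual norm topology on the complex numbers R[i]; it gives C^n, that is
   'rV[R[i]]_n, the product topology. *)
HB.instance Definition _ (R : realType) := NormedModule.copy R[i] R[i]^o.

(* The modulus as an element of R; the norm `|z| of R[i] has values in R[i]. *)
Notation normc := ComplexField.Normc.normc.

(* A partition k of n is a function of j : 'I_s; khat k j is the sum of the
   first j parts. Indices t : 'I_n start at 0, so that the (j+1)-st block is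
   khat k j <= t < khat k j.+1 = khat k j + k j. *)
Definition is_partition (n s : nat) (k : 'I_s -> nat) : Prop :=
  (forall j, (0 < k j)%N) /\ (\sum_j k j = n)%N.

Definition khat (s : nat) (k : 'I_s -> nat) (j : nat) : nat :=
  (\sum_(i < s | (i < j)%N) k i)%N.

Definition in_block (n s : nat) (k : 'I_s -> nat) (j : 'I_s) (t : 'I_n) : bool :=
  (khat k j <= t < khat k j.+1)%N.

Definition cmul (R : realType) (n : nat) (x y : 'rV[R[i]]_n) : 'rV[R[i]]_n :=
  \row_t (x 0 t * y 0 t).

Definition torus (R : realType) (n : nat) : set 'rV[R[i]]_n :=
  [set x : 'rV[R[i]]_n | forall t, `|x 0 t| = 1].

Definition Omega (R : realType) (n : nat) (p : 'I_n -> nat) : set 'rV[R[i]]_n :=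
  [set z : 'rV[R[i]]_n | \sum_t normc (z 0 t) ^+ (2 * p t) < 1].

Definition radii (R : realType) (n s : nat) (p : 'I_n -> nat) (k : 'I_s -> nat)
    (z : 'rV[R[i]]_n) : 'rV[R]_s :=
  \row_j Num.sqrt (\sum_(t | in_block k j t) normc (z 0 t) ^+ (2 * p t)).

(* The sum over j has a single term, the one of the block containing t. *)
Definition xi (R : realType) (n s : nat) (p : 'I_n -> nat) (k : 'I_s -> nat)
    (z : 'rV[R[i]]_n) : 'rV[R[i]]_n :=
  \row_t \sum_(j | in_block k j t)
    (if radii p k z 0 j == 0 then 0
     else z 0 t * (radii p k z 0 j `^ (- (p t)%:R^-1))%:C).

Definition monomial (R : realType) (n : nat) (nu mu : 'I_n -> nat)
    (x : 'rV[R[i]]_n) : R[i] :=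
  \prod_t (x 0 t ^+ nu t * (x 0 t)^* ^+ mu t).

Definition box (R : realType) (n : nat) (l u : 'rV[R[i]]_n) : set 'rV[R[i]]_n :=
  [set z : 'rV[R[i]]_n | forall t,
    (complex.Re (l 0 t) <= complex.Re (z 0 t) <= complex.Re (u 0 t)) /\
    (complex.Im (l 0 t) <= complex.Im (z 0 t) <= complex.Im (u 0 t))].

Definition box_volume (R : realType) (n : nat) (l u : 'rV[R[i]]_n) : \bar R :=
  (\prod_(t < n)
    (lebesgue_measure `[complex.Re (l 0%R t), complex.Re (u 0%R t)] *
     lebesgue_measure `[complex.Im (l 0%R t), complex.Im (u 0%R t)]))%E.

Definition lebesgue_null (R : realType) (n : nat) (N : set 'rV[R[i]]_n) : Prop :=
  forall e : R, 0 < e -> exists (D : set nat) (l u : nat -> 'rV[R[i]]_n),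
    N `<=` \bigcup_(i in D) box (l i) (u i) /\
    (\esum_(i in D) box_volume (l i) (u i) <= e%:E)%E.

(* Lebesgue measurable subsets of C^n = R^(2n): the completion of the Borel
   sigma-algebra. *)
Definition lebesgue_measurable (R : realType) (n : nat) (A : set 'rV[R[i]]_n)
    : Prop :=
  exists2 B : set 'rV[R[i]]_n, <<s [set U : set 'rV[R[i]]_n | open U] >> B &
    lebesgue_null ((A `\` B) `|` (B `\` A)).

Definition measurable_on (R : realType) (n : nat) (D : set 'rV[R[i]]_n)
    (a : 'rV[R[i]]_n -> R[i]) : Prop :=
  forall U : set R[i], open U -> lebesgue_measurable (D `&` a @^-1` U).

Definition bounded_fun_on (R : realType) (n : nat) (D : set 'rV[R[i]]_n)
    (a : 'rV[R[i]]_n -> R[i]) : Prop :=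
  exists M : R, forall z, D z -> normc (a z) <= M.

Definition quasi_radial (R : realType) (n s : nat) (p : 'I_n -> nat)
    (k : 'I_s -> nat) (a : 'rV[R[i]]_n -> R[i]) : Prop :=
  exists a' : 'rV[R]_s -> R[i], forall z, Omega p z -> a z = a' (radii p k z).

(* In (ii) the 1-based index of t inside block j is (t - khat k j).+1; it
   exceeds h j if and only if khat k j + h j <= t. *)
Definition admissible (n s : nat) (p : 'I_n -> nat) (k h : 'I_s -> nat)
    (nu mu : 'I_n -> nat) : Prop :=
  [/\ (\sum_t nu t * mu t = 0)%N,
      forall j, \sum_(t | in_block k j t)
        ((nu t)%:R - (mu t)%:R) / (p t)%:R = 0 :> rat,
      forall j t, in_block k j t -> (khat k j + h j <= t)%N -> nu t = 0%N &
      forall j t, in_block k j t -> (t < khat k j + h j)%N -> mu t = 0%N].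

(* A function on Omega p is given by a total function, whose values outside
   Omega p are irrelevant. *)
Definition symbols (R : realType) (n s : nat) (p : 'I_n -> nat)
    (k h : 'I_s -> nat) : set ('rV[R[i]]_n -> R[i]) :=
  [set phi | exists (a : 'rV[R[i]]_n -> R[i]) (nu mu : 'I_n -> nat),
    [/\ bounded_fun_on (Omega p) a,
        measurable_on (Omega p) a,
        quasi_radial p k a,
        admissible p k h nu mu &
        forall z, Omega p z -> phi z = a z * monomial nu mu (xi p k z)]].

Definition torus_subgroup (R : realType) (n : nat) (G : set 'rV[R[i]]_n) : Prop :=
  [/\ G `<=` @torus R n,
      G (const_mx 1),
      forall x y, G x -> G y -> G (cmul x y) &
      forall x, G x -> G (map_mx GRing.inv x)].

Definition connected_invariance_subgroup (R : realType) (n s : nat)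
    (p : 'I_n -> nat) (k h : 'I_s -> nat) (G : set 'rV[R[i]]_n) : Prop :=
  [/\ torus_subgroup G, connected G &
      forall tau, G tau -> forall phi, symbols p k h phi ->
        forall z, Omega p z -> phi (cmul tau z) = phi z].

Definition is_maximal_connected_invariance_subgroup (R : realType) (n s : nat)
    (p : 'I_n -> nat) (k h : 'I_s -> nat) (G : set 'rV[R[i]]_n) : Prop :=
  connected_invariance_subgroup p k h G /\
  forall G', connected_invariance_subgroup p k h G' -> G `<=` G' -> G' = G.

Definition lcm_weights (n : nat) (p : 'I_n -> nat) : nat :=
  (\big[lcmn/1]_t p t)%N.

Definition Lambda (n : nat) (p : 'I_n -> nat) (t : 'I_n) : nat :=
  (lcm_weights p %/ p t)%N.

Definition torus_hom (R : realType) (n : nat) (p : 'I_n -> nat)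
    (x : 'rV[R[i]]_n) : 'rV[R[i]]_n :=
  \row_t (x 0 t ^+ Lambda p t).

Definition block_torus (R : realType) (n s : nat) (k : 'I_s -> nat)
    : set 'rV[R[i]]_n :=
  [set tau : 'rV[R[i]]_n | torus tau /\ exists2 w : 'rV[R[i]]_s, torus w &
    forall j t, in_block k j t -> tau 0 t = w 0 j].

(* Isomorphism of topological groups. *)
Definition torus_group_isomorphic (R : realType) (m n : nat)
    (G : set 'rV[R[i]]_m) (H : set 'rV[R[i]]_n) : Prop :=
  exists (f : 'rV[R[i]]_m -> 'rV[R[i]]_n) (g : 'rV[R[i]]_n -> 'rV[R[i]]_m),
    [/\ (forall x, G x -> H (f x) /\ g (f x) = x),
        (forall y, H y -> G (g y) /\ f (g y) = y),
        (forall x y, G x -> G y -> f (cmul x y) = cmul (f x) (f y)),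
        {within G, continuous f} &
        {within H, continuous g}].

(* Main.v *)
(** An invariant torus element tau satisfies tau_t1^(p_t1) = tau_t2^(p_t2) as
soon as t1 and t2 lie in the two parts (cut at h_j) of the same block j: take
a = 1, nu = p_t1 at t1 and mu = p_t2 at t2.  Both parts are nonempty, so
tau_t^(p_t) takes a single value c_j on the block.  Dividing the exponents
Lambda_t of a block by their gcd gives coprime exponents lam_t with the same
image group G = {(u_j^(lam_t))}, and a Bezout relation
sum a_t lam_t = 1 + sum b_t lam_t turns the monomial
f_j(tau) = prod tau_t^(a_t) conj(tau_t)^(b_t) into a continuous inverse of the
parametrization u |-> (u_j^(lam_t)); hence G is a closed torus.  For an
invariant tau, the ratio tau_t / f_j(tau)^(lam_t) is a p_t-th root of unity: being
continuous in tau, it is constant on a connected invariance subgroup, hence 1,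
and that subgroup is contained in G. *)

Require Import Defs.
From mathcomp Require Import all_boot all_order all_algebra.
From mathcomp Require Import all_classical all_reals all_analysis.
From mathcomp Require Import complex.
From mathcomp Require Import zify.
Import numFieldNormedType.Exports.
Local Open Scope classical_set_scope.
Local Open Scope ring_scope.
Set Implicit Arguments.
Unset Strict Implicit.
Unset Printing Implicit Defensive.
Import Order.TTheory GRing.Theory Num.Theory.

(** * Topology of complex tuples *)

(** A neighbourhood of a row contains a product of entrywise neighbourhoods, and only finitely many
    preimages have to be intersected. *)
Lemma continuous_rV (T U : topologicalType) (m : nat) (f : T -> 'rV[U]_m) :
  (forall t, continuous (fun x => f x 0 t)) -> continuous f.
Proof.
move=> fc x A [P Pf PA].
have : \forall y \near x, forall t : 'I_m, P 0 t (f y 0 t).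
  apply: filter_forall => t; exact: (fc t x (P 0 t) (Pf 0 t)).
apply: filterS => y Py; apply: PA => i t; rewrite ord1; exact: Py.
Qed.

Lemma rV_coord_continuous (U : topologicalType) (m : nat) (t : 'I_m) :
  continuous (fun x : 'rV[U]_m => x 0 t).
Proof.
move=> x A Ax; exists (fun _ t' => if t' == t then A else setT) => /=.
  by move=> i t'; rewrite ord1; case: eqP => [->//|_]; exact: filterT.
by move=> y /(_ 0 t); rewrite eqxx.
Qed.

Section complex_continuity.
Variable R : realType.

Lemma continuous_conjc : continuous (@conjc R : R[i] -> R[i]).
Proof.
move=> x A /nbhs_ballP[e e0 eA]; apply/nbhs_ballP; exists e => // y xy.
apply: eA; move: xy; rewrite -!ball_normE /= => xy.
by rewrite -rmorphB normcJ.
Qed.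

Lemma continuous_real_complex : continuous (@real_complex R : R -> R[i]).
Proof.
move=> x A /nbhs_ballP[[e e'] /= e0 eA].
move: e0; rewrite ltcE /= => /andP[/eqP e'0 e0].
apply/nbhs_ballP; exists e => // y xy; apply: eA; move: xy.
rewrite -!ball_normE /= => xy.
by rewrite -rmorphB normc_def /= expr0n addr0 sqrtr_sqr ltcE /= e'0 eqxx.
Qed.

Lemma continuous_mulc (T : topologicalType) (f g : T -> R[i]) :
  continuous f -> continuous g -> continuous (fun x => f x * g x).
Proof. by move=> fc gc x; exact: (cvgM (fc x) (gc x)). Qed.

Lemma continuous_addc (T : topologicalType) (f g : T -> R[i]) :
  continuous f -> continuous g -> continuous (fun x => f x + g x).
Proof. by move=> fc gc x; exact: (cvgD (fc x) (gc x)). Qed.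

Lemma continuous_exprc (T : topologicalType) (f : T -> R[i]) m :
  continuous f -> continuous (fun x => f x ^+ m).
Proof.
move=> fc; elim: m => [|m ih].
  by under eq_fun do rewrite expr0; move=> x; exact: cvg_cst.
by under eq_fun do rewrite exprS; exact: continuous_mulc.
Qed.

Lemma continuous_conj (T : topologicalType) (f : T -> R[i]) :
  continuous f -> continuous (fun x => (f x)^*).
Proof.
by move=> fc x; apply: continuous_comp; [exact: fc|exact: continuous_conjc].
Qed.

Lemma continuous_sumc (T : topologicalType) (I : Type)
    (r : seq I) (P : pred I) (f : I -> T -> R[i]) :
  (forall i, continuous (f i)) ->
  continuous (fun x => \sum_(i <- r | P i) f i x).
Proof.
move=> fc; elim: r => [|i r ih].
  by under eq_fun do rewrite big_nil; move=> x; exact: cvg_cst.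
under eq_fun do rewrite big_cons.
by case: (P i); [exact: (continuous_addc (fc i) ih)|exact: ih].
Qed.

Lemma continuous_prodc (T : topologicalType) (I : Type)
    (r : seq I) (P : pred I) (f : I -> T -> R[i]) :
  (forall i, continuous (f i)) ->
  continuous (fun x => \prod_(i <- r | P i) f i x).
Proof.
move=> fc; elim: r => [|i r ih].
  by under eq_fun do rewrite big_nil; move=> x; exact: cvg_cst.
under eq_fun do rewrite big_cons.
by case: (P i); [exact: (continuous_mulc (fc i) ih)|exact: ih].
Qed.

Lemma continuous_monomial n (nu mu : 'I_n -> nat) :
  continuous (@monomial R n nu mu).
Proof.
apply: continuous_prodc => t; apply: continuous_mulc; apply: continuous_exprc.
  exact: rV_coord_continuous.
by apply: continuous_conj; exact: rV_coord_continuous.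
Qed.

Lemma normc_real (x : R[i]) : `|x| = (normc x)%:C%C.
Proof. by case: x. Qed.

Lemma normc_ge0 (x : R[i]) : 0 <= normc x.
Proof. by case: x => a b; rewrite /= sqrtr_ge0. Qed.

Lemma Omega_open n (p : 'I_n -> nat) : open (@Omega R n p).
Proof.
(* The defining sum, rewritten through |z|^2 = z z^*, is a visibly continuous complex function;
   [Omega p] is its preimage of the unit ball. *)
pose f (z : 'rV[R[i]]_n) : R[i] := \sum_t (z 0 t * (z 0 t)^*) ^+ p t.
have fE z : f z = (\sum_t normc (z 0 t) ^+ (2 * p t))%:C%C.
  rewrite rmorph_sum; apply: eq_bigr => t _.
  by rewrite -sqr_normc normc_real -exprM rmorphXn.
have fc : continuous f.
  apply: continuous_sumc => t; apply: continuous_exprc; apply: continuous_mulc.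
    exact: rV_coord_continuous.
  by apply: continuous_conj; exact: rV_coord_continuous.
suff -> : Omega p = f @^-1` ball 0 1.
  by apply: open_comp => [z _|]; [exact: fc|exact: ball_open].
apply/seteqP; split=> z; rewrite /Omega -ball_normE /= sub0r normrN fE => hz.
  rewrite normc_real /= expr0n addr0 sqrtr_sqr ger0_norm ?ltcR //.
  by rewrite sumr_ge0 // => t _; rewrite exprn_ge0 // normc_ge0.
move: hz; rewrite normc_real /= expr0n addr0 sqrtr_sqr ltcR.
exact: le_lt_trans (ler_norm _).
Qed.

Lemma continuous_cis : continuous (fun x : R => (cos x +i* sin x)%C : R[i]).
Proof.
have -> : (fun x : R => (cos x +i* sin x)%C) =
    (fun x => (cos x)%:C%C + 'i%C * (sin x)%:C%C).
  apply/funext => x; apply/eqP.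
  by rewrite eq_complex /= !mul0r mulr0 mul1r subrr !add0r addr0 !eqxx.
apply: continuous_addc; last apply: continuous_mulc; move=> x.
- apply: continuous_comp; [exact: continuous_cos|exact: continuous_real_complex].
- exact: cvg_cst.
apply: continuous_comp; [exact: continuous_sin|exact: continuous_real_complex].
Qed.

Lemma unit_cis (w : R[i]) : `|w| = 1 -> exists x : R, w = (cos x +i* sin x)%C.
Proof.
case: w => a b; rewrite normc_def /= => -[] ab1.
have {}ab1 : a ^+ 2 + b ^+ 2 = 1.
  by rewrite -[LHS]sqr_sqrtr ?ab1 ?expr1n// addr_ge0 ?sqr_ge0.
have a1 : -1 <= a <= 1.
  rewrite -ler_norml -(expr_le1 (n := 2))// real_normK ?num_real// -ab1.
  by rewrite lerDl sqr_ge0.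
have s : sin (acos a) = `|b|.
  by rewrite sin_acos// -ab1 addrAC subrr add0r sqrtr_sqr.
(* [acos] only reaches the upper half circle; the lower half takes the opposite angle. *)
case: (lerP 0 b) => b0.
  by exists (acos a); rewrite acosK // s ger0_norm.
by exists (- acos a); rewrite cosN acosK // sinN s ltr0_norm // opprK.
Qed.

Lemma norm_cis (x : R) : `|(cos x +i* sin x)%C : R[i]| = 1.
Proof. by rewrite normc_def /= cos2Dsin2 sqrtr1. Qed.

Lemma closed_finite_set (A : set R[i]) : finite_set A -> closed A.
Proof.
exact: (accessible_finite_set_closed.1
  (hausdorff_accessible (@norm_hausdorff _ R[i]))).
Qed.

Lemma closed_eqfun (T : topologicalType) (g1 g2 : T -> R[i]) :
  continuous g1 -> continuous g2 -> closed [set x | g1 x = g2 x].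
Proof.
move=> c1 c2.
have cd : continuous (fun x => g1 x - g2 x).
  by move=> x; exact: (cvgB (c1 x) (c2 x)).
suff -> : [set x | g1 x = g2 x] = (fun x => g1 x - g2 x) @^-1` [set 0].
  move/continuous_closedP : cd; apply.
  by apply: closed_finite_set; exact: finite_set1.
apply/seteqP; split=> x /= e; first by rewrite e subrr.
by apply/eqP; rewrite -subr_eq0 e.
Qed.

(** Finite sets are closed, so {x} is both relatively open and relatively closed in [A]. *)
Lemma connected_finite (A : set R[i]) (x y : R[i]) :
  connected A -> finite_set A -> A x -> A y -> x = y.
Proof.
move=> cA fA Ax Ay; suff : [set x] = A by move=> AE; move: Ay; rewrite -AE.
apply: cA; first by exists x.
- exists (~` (A `\ x)).
    by apply: closed_openC; apply: closed_finite_set; exact: finite_setD.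
  apply/seteqP; split => z; first by move=> ->; split=> // -[_]; exact.
  by move=> [Az nz]; apply: contrapT => zx; exact: nz.
- exists [set x]; first by apply: closed_finite_set; exact: finite_set1.
  by apply/seteqP; split => z /=; [move=> ->|case].
Qed.

Lemma finite_unity_root (m : nat) :
  (0 < m)%N -> finite_set [set x : R[i] | x ^+ m = 1].
Proof.
move=> m0; have [rs /= e] := closed_field_poly_normal ('X^m - 1 : {poly R[i]}).
apply: (@sub_finite_set _ _ [set` rs]) => // x /= xm1.
(* The list [rs] of linear factors contains every root of X^m - 1; its leading coefficient is
   nonzero because m > 0. *)
rewrite -root_prod_XsubC -(@rootZ _ _ (lead_coef ('X^m - 1 : {poly R[i]}))).
  by rewrite -e /root !hornerE xm1 subrr.
by rewrite lead_coef_eq0 -size_poly_eq0 size_XnsubC.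
Qed.

End complex_continuity.

(** * Exponents and blocks *)

(** Bezout's relation stays in [nat] by moving negative terms to the right; [a] and [b] will serve
    as exponents of a variable and of its conjugate. *)
Lemma bezout_biggcdn (I : eqType) (r : seq I) (F : I -> nat) : uniq r ->
  exists a b : I -> nat, (\sum_(i <- r) a i * F i =
    \big[gcdn/0]_(i <- r) F i + \sum_(i <- r) b i * F i)%N.
Proof.
elim: r => [_|x r ih /= /andP[xr /ih[a [b ab]]]].
  by exists (fun=> 0%N), (fun=> 0%N); rewrite !big_nil.
have upd (c : I -> nat) u :
    (\sum_(i <- r) (if i == x then u else c i) * F i =
     \sum_(i <- r) c i * F i)%N.
  by apply: eq_big_seq => i ir; case: eqP => // ix; rewrite -ix ir in xr.
have [Fx0|Fx0] := posnP (F x).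
  exists (fun i => if i == x then 0 else a i)%N,
         (fun i => if i == x then 0 else b i)%N.
  by rewrite !big_cons !upd !eqxx Fx0 gcd0n muln0.
(* With g the gcd over [r], this gives km F(x) = kn g + gcd(F(x), g). Since kn g is on the right,
   the relation for [r] enters with its two sides swapped. *)
case: (egcdnP (\big[gcdn/0]_(i <- r) F i) Fx0) => km kn e _.
exists (fun i => if i == x then km else kn * b i)%N,
       (fun i => if i == x then 0 else kn * a i)%N.
have distr (c : I -> nat) :
    (\sum_(i <- r) kn * c i * F i = kn * \sum_(i <- r) c i * F i)%N.
  by rewrite big_distrr /=; apply: eq_bigr => i _; rewrite mulnA.
by rewrite !big_cons !upd !eqxx !distr ab mulnDr e mul0n add0n addnCA addnA.
Qed.

Lemma khatS s (k : 'I_s -> nat) (j : 'I_s) : khat k j.+1 = (khat k j + k j)%N.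
Proof.
rewrite /khat (bigD1 j) //= addnC; congr (_ + _)%N; apply: eq_bigl => i.
by rewrite ltnS ltn_neqAle andbC.
Qed.

Lemma leq_khat s (k : 'I_s -> nat) i j : (i <= j)%N -> (khat k i <= khat k j)%N.
Proof.
move=> ij; rewrite /khat big_mkcond [leqRHS]big_mkcond leq_sum //= => l _.
by case: ifP => // /leq_trans -> .
Qed.

Lemma khat_total n s (k : 'I_s -> nat) : is_partition n k -> khat k s = n.
Proof. by case=> _ <-; apply: eq_bigl => i; rewrite ltn_ord. Qed.

Lemma in_block_inj n s (k : 'I_s -> nat) (i j : 'I_s) (t : 'I_n) :
  in_block k i t -> in_block k j t -> i = j.
Proof.
move=> /andP[it ti] /andP[jt tj]; apply: val_inj => /=; apply/eqP.
rewrite eqn_leq; apply/andP; split; rewrite leqNgt; apply/negP.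
  by move=> /(leq_khat k) ji;
    have := leq_trans (leq_trans tj ji) it; rewrite ltnn.
by move=> /(leq_khat k) ij;
  have := leq_trans (leq_trans ti ij) jt; rewrite ltnn.
Qed.

(** The block of [t] ends at the least m with t < [khat k m]; m = 0 is excluded because [khat k 0]
    is an empty sum. *)
Lemma in_block_ex n s (k : 'I_s -> nat) (t : 'I_n) :
  is_partition n k -> exists j, in_block k j t.
Proof.
move=> kp; have ex : exists m, (t < khat k m)%N.
  by exists s; rewrite (khat_total kp).
case: (ex_minnP ex) => -[|j] tj jmin.
  by rewrite /khat big1 in tj.
have js : (j < s)%N.
  by apply: jmin; rewrite (khat_total kp).
exists (Ordinal js); rewrite /in_block /= tj andbT leqNgt.
by apply/negP => /jmin; rewrite ltnn.
Qed.

(** * Monomials in the coordinates and their conjugates *)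

Section monomials.
Variables (R : realType) (n : nat).
Implicit Types (x y : 'rV[R[i]]_n) (nu mu : 'I_n -> nat) (z : R[i]).

Lemma mulr_conj z : `|z| = 1 -> z * z^* = 1.
Proof. by move=> z1; rewrite -normCK z1 expr1n. Qed.

Lemma monomialM nu mu x y :
  monomial nu mu (cmul x y) = monomial nu mu x * monomial nu mu y.
Proof.
rewrite /monomial -big_split; apply: eq_bigr => t _.
by rewrite mxE rmorphM !exprMn mulrACA.
Qed.

Lemma monomial_exprn nu mu x m :
  monomial nu mu (\row_t x 0 t ^+ m) = monomial nu mu x ^+ m.
Proof.
rewrite /monomial -prodrXl; apply: eq_bigr => t _.
by rewrite mxE rmorphXn exprMn -!exprM ![(m * _)%N]mulnC.
Qed.

Lemma norm_monomial nu mu x : torus x -> `|monomial nu mu x| = 1.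
Proof.
move=> x1; rewrite /monomial normr_prod big1 // => t _.
by rewrite normrM !normrX norm_conjC x1 !expr1n mulr1.
Qed.

Lemma monomial_neq0 nu mu x : (forall t, x 0 t != 0) -> monomial nu mu x != 0.
Proof.
move=> x0; apply/prodf_neq0 => t _.
by rewrite mulf_neq0 // expf_neq0 ?conjC_eq0.
Qed.

Lemma monomial_pair (t1 t2 : 'I_n) (m1 m2 : nat) x :
  monomial (fun t => if t == t1 then m1 else 0%N)
    (fun t => if t == t2 then m2 else 0%N) x = x 0 t1 ^+ m1 * (x 0 t2)^* ^+ m2.
Proof.
rewrite /monomial big_split /= (bigD1 t1) //= eqxx big1; last first.
  by move=> t /negbTE ->.
rewrite (bigD1 t2) //= eqxx big1 ?mulr1 //.
by move=> t /negbTE ->.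
Qed.

(** Applied to a block of an element of [block_powers], this reduces a monomial to powers of a
    single parameter and its conjugate. *)
Lemma prod_common_base (P : pred 'I_n) (lam : 'I_n -> nat) (w : R[i]) nu mu x :
  (forall t, P t -> x 0 t = w ^+ lam t) ->
  \prod_(t | P t) (x 0 t ^+ nu t * (x 0 t)^* ^+ mu t) =
    w ^+ (\sum_(t | P t) nu t * lam t) * w^* ^+ (\sum_(t | P t) mu t * lam t).
Proof.
move=> xw; rewrite !expr_sum -big_split; apply: eq_bigr => t /xw ->.
by rewrite rmorphXn -!exprM ![(lam t * _)%N]mulnC.
Qed.

End monomials.

Section blocks.
Variables (n s : nat) (k : 'I_s -> nat).
Hypothesis k_partition : is_partition n k.

Lemma big_in_block1 (T : Type) (idx : T) (op : Monoid.com_law idx)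
    (F : 'I_s -> T) (j : 'I_s) (t : 'I_n) : in_block k j t ->
  \big[op/idx]_(i | in_block k i t) F i = F j.
Proof.
move=> jt; rewrite (bigD1 j) //= big1 ?Monoid.mulm1 // => i /andP[it].
by rewrite (in_block_inj it jt) eqxx.
Qed.

Lemma big_blocks (T : Type) (idx : T) (op : Monoid.com_law idx)
    (F : 'I_n -> T) :
  \big[op/idx]_t F t = \big[op/idx]_j \big[op/idx]_(t | in_block k j t) F t.
Proof.
rewrite (exchange_big_dep predT) //=; apply: eq_bigr => t _.
by have [j jt] := in_block_ex t k_partition; rewrite (big_in_block1 _ _ jt).
Qed.

End blocks.

(** * Invariant elements *)

Section invariance.
Variables (R : realType) (n s : nat) (p : 'I_n -> nat) (k h : 'I_s -> nat).
Hypothesis p_gt0 : forall t, (0 < p t)%N.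
Hypothesis k_partition : is_partition n k.
Implicit Types (x y z tau : 'rV[R[i]]_n).

Lemma normc_mul_torus tau z t : torus tau ->
  normc (cmul tau z 0 t) = normc (z 0 t).
Proof.
move=> tau1; rewrite mxE ComplexField.Normc.normcM.
by have := tau1 t; rewrite normc_real => -[->]; rewrite mul1r.
Qed.

Lemma Omega_cmul tau z : torus tau -> Omega p z -> Omega p (cmul tau z).
Proof.
move=> tau1; rewrite /Omega /=.
by under [in X in _ -> X]eq_bigr do rewrite normc_mul_torus //.
Qed.

Lemma radii_cmul tau z : torus tau -> radii p k (cmul tau z) = radii p k z.
Proof.
move=> tau1; apply/rowP => j; rewrite !mxE; congr Num.sqrt.
by apply: eq_bigr => t _; rewrite normc_mul_torus.
Qed.

Lemma xi_cmul tau z : torus tau -> xi p k (cmul tau z) = cmul tau (xi p k z).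
Proof.
move=> tau1; apply/rowP => t; rewrite !mxE big_distrr /=.
apply: eq_bigr => j _; rewrite radii_cmul //.
by case: ifP; rewrite ?mulr0 // mxE mulrA.
Qed.

(** The action fixes the radii, hence the quasi-radial factor, and [xi] is equivariant; a symbol is
    thus multiplied by its monomial at [tau]. *)
Lemma symbols_torus_invariant tau : torus tau ->
  (forall nu mu, admissible p k h nu mu -> monomial nu mu tau = 1) ->
  forall phi, symbols p k h phi ->
  forall z, Omega p z -> phi (cmul tau z) = phi z.
Proof.
move=> tau1 mono1 phi [a [nu [mu [_ _ [a' aE] adm phiE]]]] z Oz.
have Otz := Omega_cmul tau1 Oz.
rewrite (phiE _ Otz) (phiE _ Oz) (aE _ Otz) (aE _ Oz) (radii_cmul _ tau1).
by rewrite (xi_cmul _ tau1) monomialM (mono1 _ _ adm) mul1r.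
Qed.

Lemma lebesgue_null0 : lebesgue_null (set0 : set 'rV[R[i]]_n).
Proof.
move=> e e0; exists set0, (fun=> 0), (fun=> 0); split; first by move=> ?.
by rewrite esum_set0 lee_fin ltW.
Qed.

Lemma lebesgue_measurable_open (A : set 'rV[R[i]]_n) :
  open A -> lebesgue_measurable A.
Proof.
move=> oA; exists A; first exact: sub_sigma_algebra.
by rewrite setDv setU0; exact: lebesgue_null0.
Qed.

(** With quasi-radial factor 1, the preimages to be measured are [Omega p] or empty, both open. *)
Lemma monomial_xi_symbol nu mu : admissible p k h nu mu ->
  symbols p k h (fun z => monomial nu mu (xi p k z) : R[i]).
Proof.
move=> adm; exists (fun=> 1), nu, mu; split=> //.
- by exists 1 => z _; rewrite ComplexField.Normc.normc1.
- move=> U _; have [U1|U1] := pselect (U 1).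
    rewrite preimage_cst ifT ?inE // setIT.
    by apply: lebesgue_measurable_open; exact: Omega_open.
  rewrite preimage_cst ifF ?setI0; last by apply/negbTE/negP; rewrite inE.
  by apply: lebesgue_measurable_open; exact: open0.
- by exists (fun=> 1).
- by move=> z _; rewrite mul1r.
Qed.

(** A test point where every monomial in [xi] is nonzero and can be cancelled from an invariance
    equation. *)
Lemma Omega_all_neq0 :
  exists2 z, Omega p z & forall t, xi p k z 0 t != 0 :> R[i].
Proof.
(* Each of the n terms is at most 1/(n+1), so their sum stays below 1. *)
pose e : R := n.+1%:R^-1.
have e0 : 0 < e by rewrite invr_gt0.
have e1 : e <= 1 by rewrite invf_le1 // ler1n.
have ne : normc (e%:C%C) = e.
  by rewrite /= expr0n addr0 sqrtr_sqr gtr0_norm.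
exists (const_mx e%:C%C).
  rewrite /Omega /=.
  have le t : normc ((const_mx e%:C%C : 'rV[R[i]]_n) 0 t) ^+ (2 * p t) <= e.
    rewrite mxE ne; have /prednK <- : (0 < 2 * p t)%N.
      by rewrite mulSn addn_gt0 p_gt0.
    by rewrite exprS ler_piMr ?exprn_ile1 ?(ltW e0).
  apply: le_lt_trans (ler_sum _ (fun t _ => le t)) _.
  by rewrite sumr_const card_ord -mulr_natl ltr_pdivrMr // mul1r ltr_nat.
move=> t; have [j jt] := in_block_ex t k_partition.
have r0 : 0 < radii p k (const_mx e%:C%C) 0 j.
  rewrite mxE sqrtr_gt0 (bigD1 t) //= ltr_wpDr //.
    by apply: sumr_ge0 => i _; rewrite exprn_ge0 // normc_ge0.
  by rewrite mxE ne exprn_gt0.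
rewrite mxE (big_in_block1 _ _ jt) (gt_eqF r0) mulf_neq0 ?fmorph_eq0 //.
  by rewrite mxE fmorph_eq0 gt_eqF.
by rewrite gt_eqF // powR_gt0.
Qed.

End invariance.

(** * Common powers of the coordinates along a block *)

Section common_powers.
Variables (R : realType) (n s : nat) (p : 'I_n -> nat) (k h : 'I_s -> nat).
Hypothesis p_gt0 : forall t, (0 < p t)%N.
Hypothesis k_partition : is_partition n k.
Hypothesis h_bounds : forall j, (1 <= h j <= k j - 1)%N.
Implicit Types (tau : 'rV[R[i]]_n).

(** The exponents cancel the weights 1/p_t, so block [j] has balance 1 - 1 and the other blocks 0;
    the sides of the cut are those prescribed by (ii). *)
Lemma admissible_pair (j : 'I_s) (t1 t2 : 'I_n) :
  in_block k j t1 -> in_block k j t2 ->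
  (t1 < khat k j + h j)%N -> (khat k j + h j <= t2)%N ->
  admissible p k h (fun t => if t == t1 then p t1 else 0%N)
    (fun t => if t == t2 then p t2 else 0%N).
Proof.
move=> jt1 jt2 lt1 ge2; have t12 : t1 != t2.
  by apply/eqP => e; rewrite -e leqNgt lt1 in ge2.
have frac (i : 'I_s) (t0 : 'I_n) : in_block k j t0 ->
    \sum_(t | in_block k i t) (if t == t0 then p t0 else 0%N)%:R / (p t)%:R
      = (i == j)%:R :> rat.
  move=> jt0; have [->|ij] := eqVneq i j.
    rewrite (bigD1 t0) //= eqxx divff ?pnatr_eq0 -?lt0n // big1 ?addr0 //.
    by move=> t /andP[_ /negbTE ->]; rewrite mul0r.
  rewrite big1 // => t it; case: eqP => [tt0|]; last by rewrite mul0r.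
  by rewrite tt0 in it; rewrite (in_block_inj it jt0) eqxx in ij.
split.
- rewrite big1 // => t _; case: eqP => [->|_]; last by rewrite mul0n.
  by rewrite (negbTE t12) muln0.
- move=> i; under eq_bigr do rewrite mulrBl.
  by rewrite sumrB !frac // subrr.
- move=> i t it ge; case: eqP => // tt1; rewrite {t}tt1 in it ge.
  by rewrite (in_block_inj it jt1) leqNgt lt1 in ge.
- move=> i t it lt; case: eqP => // tt2; rewrite {t}tt2 in it lt.
  by rewrite (in_block_inj it jt2) ltnNge ge2 in lt.
Qed.

Lemma common_power tau : torus tau ->
  (forall phi, symbols p k h phi ->
    forall z, Omega p z -> phi (cmul tau z) = phi z) ->
  forall j, exists c : R[i], `|c| = 1 /\
    forall t, in_block k j t -> tau 0 t ^+ p t = c.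
Proof.
move=> tau1 inv j; have [z Oz z0] := Omega_all_neq0 R p_gt0 k_partition.
have pair (t1 t2 : 'I_n) : in_block k j t1 -> in_block k j t2 ->
    (t1 < khat k j + h j)%N -> (khat k j + h j <= t2)%N ->
    tau 0 t1 ^+ p t1 = tau 0 t2 ^+ p t2.
  move=> jt1 jt2 lt1 ge2.
  have adm := admissible_pair jt1 jt2 lt1 ge2.
  have := inv _ (monomial_xi_symbol _ adm) z Oz.
  rewrite (xi_cmul _ _ _ tau1) monomialM -[RHS]mul1r.
  move=> /(mulIf (monomial_neq0 _ _ z0)); rewrite monomial_pair => e.
  by rewrite -[LHS]mulr1 -(expr1n _ (p t2)) -(mulr_conj (tau1 t2)) exprMn
     mulrCA e mulr1.
have := h_bounds j; have kn : (khat k j + k j <= n)%N.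
  by rewrite -khatS -[leqRHS](khat_total k_partition) leq_khat.
(* Reference indices: the first of the block and the first past the cut, on opposite sides since 1
   <= h_j <= k_j - 1. *)
move=> hj; have t1n : (khat k j < n)%N by lia.
have t2n : (khat k j + h j < n)%N by lia.
have jt1 : in_block k j (Ordinal t1n) by rewrite /in_block khatS /=; lia.
have jt2 : in_block k j (Ordinal t2n) by rewrite /in_block khatS /=; lia.
exists (tau 0 (Ordinal t2n) ^+ p (Ordinal t2n)); split.
  by rewrite normrX tau1 expr1n.
move=> t jt; have [lt|ge] := ltnP t (khat k j + h j).
  exact: pair.
(* Two indices past the cut are compared through the first index of the block. *)
rewrite -(pair (Ordinal t1n) t) //=; last by lia.
by apply: pair => //=; lia.
Qed.

End common_powers.

(** * The group of block powers *)

(* When the exponents of each block are coprime, [block_coord] recovers [u] from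
   the element of [block_powers] it parametrizes; [a] and [b] are the positive
   and negative Bezout coefficients. *)
Definition block_powers (R : realType) (n s : nat) (k : 'I_s -> nat)
    (lam : 'I_s -> 'I_n -> nat) : set 'rV[R[i]]_n :=
  [set x : 'rV[R[i]]_n | exists2 u : 'rV[R[i]]_s, torus u &
    forall j t, in_block k j t -> x 0 t = u 0 j ^+ lam j t].

Definition block_coord (R : realType) (n s : nat) (k : 'I_s -> nat)
    (a b : 'I_s -> 'I_n -> nat) (x : 'rV[R[i]]_n) : 'rV[R[i]]_s :=
  \row_j monomial (fun t => if in_block k j t then a j t else 0%N)
    (fun t => if in_block k j t then b j t else 0%N) x.

Section block_powers.
Variables (R : realType) (n s : nat) (k : 'I_s -> nat).
Variables (lam a b : 'I_s -> 'I_n -> nat).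
Hypothesis k_partition : is_partition n k.
Hypothesis bezout : forall j, (\sum_(t | in_block k j t) a j t * lam j t =
  1 + \sum_(t | in_block k j t) b j t * lam j t)%N.
Implicit Types (x y : 'rV[R[i]]_n) (u w : 'rV[R[i]]_s).
Local Notation G := (@block_powers R n s k lam).
Local Notation f := (@block_coord R n s k a b).

Lemma block_powers_torus : G `<=` @torus R n.
Proof.
move=> x [u u1 xu] t; have [j jt] := in_block_ex t k_partition.
by rewrite (xu _ _ jt) normrX u1 expr1n.
Qed.

Lemma block_powers_subgroup : torus_subgroup G.
Proof.
split; first exact: block_powers_torus.
- exists (const_mx 1); first by move=> j; rewrite mxE normr1.
  by move=> j t _; rewrite !mxE expr1n.
- move=> x y [u u1 xu] [w w1 yw]; exists (cmul u w).
    by move=> j; rewrite mxE normrM u1 w1 mulr1.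
  by move=> j t jt; rewrite !mxE exprMn (xu _ _ jt) (yw _ _ jt).
- move=> x [u u1 xu]; exists (map_mx GRing.inv u).
    by move=> j; rewrite mxE normfV u1 invr1.
  by move=> j t jt; rewrite !mxE exprVn (xu _ _ jt).
Qed.

(** By the Bezout relation the monomial is [w] times a power of w w^* = 1. *)
Lemma block_coord_eq x j (w : R[i]) : `|w| = 1 ->
  (forall t, in_block k j t -> x 0 t = w ^+ lam j t) -> f x 0 j = w.
Proof.
move=> w1 xw; rewrite mxE /monomial.
transitivity (\prod_(t | in_block k j t) (x 0 t ^+ a j t * (x 0 t)^* ^+ b j t)).
  rewrite [RHS]big_mkcond; apply: eq_bigr => t _.
  by case: ifP => _ //; rewrite !expr0 mulr1.
rewrite (prod_common_base _ _ xw) bezout exprS -mulrA -exprMn.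
by rewrite mulr_conj // expr1n mulr1.
Qed.

Lemma block_coord_torus x : torus x -> torus (f x).
Proof. by move=> x1 j; rewrite mxE norm_monomial. Qed.

Lemma block_coordM x y : f (cmul x y) = cmul (f x) (f y).
Proof. by apply/rowP => j; rewrite !mxE monomialM. Qed.

Lemma block_coord_continuous : continuous f.
Proof.
apply: continuous_rV => j; under eq_fun do rewrite mxE.
exact: continuous_monomial.
Qed.

(** The parameter can only be [f x]; eliminating it describes the group by equations between
    continuous functions. *)
Lemma block_powersP x : G x <-> torus x /\
  forall j t, in_block k j t -> x 0 t = f x 0 j ^+ lam j t.
Proof.
split=> [Gx|[x1 xf]]; last by exists (f x) => //; exact: block_coord_torus.
split; first exact: block_powers_torus.
case: Gx => u u1 xu j t jt; rewrite (@block_coord_eq x j (u 0 j)) //.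
  exact: xu.
by move=> t'; exact: xu.
Qed.

Lemma block_coord_entry_continuous j m : continuous (fun x => f x 0 j ^+ m).
Proof.
under eq_fun do rewrite mxE.
by apply: continuous_exprc; exact: continuous_monomial.
Qed.

Lemma block_powers_closed : closed G.
Proof.
have -> : G =
    \bigcap_(t in [set: 'I_n]) [set x : 'rV[R[i]]_n | x 0 t * (x 0 t)^* = 1] `&`
    \bigcap_(jt in [set jt : 'I_s * 'I_n | in_block k jt.1 jt.2])
      [set x : 'rV[R[i]]_n | x 0 jt.2 = f x 0 jt.1 ^+ lam jt.1 jt.2].
  apply/seteqP; split => x.
    move=> /block_powersP[x1 xf]; split=> [t _|[j t] /= jt]; last exact: xf.
    by rewrite /= mulr_conj.
  move=> [x1 xf]; apply/block_powersP; split; last first.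
    by move=> j t jt; exact: (xf (j, t)).
  move=> t; apply/eqP; rewrite -(@pexpr_eq1 _ _ 2) // normCK.
  by apply/eqP; exact: x1.
apply: closedI; apply: closed_bigI => t _; apply: closed_eqfun.
- apply: continuous_mulc; first exact: rV_coord_continuous.
  by apply: continuous_conj; exact: rV_coord_continuous.
- exact: cst_continuous.
- exact: rV_coord_continuous.
- exact: block_coord_entry_continuous.
Qed.

Lemma block_powers_isomorphic : torus_group_isomorphic G (@torus R s).
Proof.
have /choice[blk blkP] := fun t : 'I_n => in_block_ex t k_partition.
pose g u : 'rV[R[i]]_n := \row_t u 0 (blk t) ^+ lam (blk t) t.
have gE u j t : in_block k j t -> g u 0 t = u 0 j ^+ lam j t.
  by move=> jt; rewrite mxE (in_block_inj jt (blkP t)).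
exists f, g; split.
- move=> x Gx; have /block_powersP[x1 xf] := Gx.
  split; first exact: block_coord_torus.
  by apply/rowP => t; rewrite (gE _ _ _ (blkP t)) -xf.
- move=> u u1; split; first by exists u => // j t; exact: gE.
  apply/rowP => j; apply: block_coord_eq => // t; exact: gE.
- by move=> x y _ _; exact: block_coordM.
- exact/continuous_subspaceT/block_coord_continuous.
- apply: continuous_subspaceT; apply: continuous_rV => t.
  under eq_fun do rewrite mxE.
  by apply: continuous_exprc; exact: rV_coord_continuous.
Qed.

(** Each element is reached at time 1 by a curve [path th] that passes through the identity at time
    0 and stays in the group. *)
Lemma block_powers_connected : connected G.
Proof.
pose path (th : 'I_s -> R) (r : R) : 'rV[R[i]]_n :=
  \row_t \prod_(j | in_block k j t)
    (cos (th j * r) +i* sin (th j * r))%C ^+ lam j t.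
have -> : G = \bigcup_th range (path th).
  apply/seteqP; split => x.
    case=> u u1 xu.
    have /choice[th thP] := fun j => unit_cis (u1 j).
    exists th => //; exists 1 => //; apply/rowP => t; rewrite mxE.
    have [j jt] := in_block_ex t k_partition.
    by rewrite (big_in_block1 _ _ jt) (xu _ _ jt) thP mulr1.
  case=> th _ [r _ <-].
  exists (\row_j (cos (th j * r) +i* sin (th j * r))%C).
    by move=> j; rewrite mxE norm_cis.
  by move=> j t jt; rewrite !mxE (big_in_block1 _ _ jt).
apply: bigcup_connected.
  exists (const_mx 1) => th _; exists 0 => //; apply/rowP => t; rewrite !mxE.
  by rewrite big1 // => j _; rewrite mulr0 cos0 sin0 expr1n.
move=> th _; apply: connected_continuous_connected.
  by apply/connected_intervalP => x y _ _ z _.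
apply: continuous_subspaceT; apply: continuous_rV => t.
under eq_fun do rewrite mxE.
apply: continuous_prodc => j; apply: continuous_exprc => r.
exact: (continuous_comp (@mulrl_continuous _ (th j) r) (@continuous_cis R _)).
Qed.

End block_powers.

(** * Invariance and maximality of the group of block powers *)

Section invariance_group.
Variables (R : realType) (n s : nat) (p : 'I_n -> nat) (k h : 'I_s -> nat).
Variables (lam a b : 'I_s -> 'I_n -> nat) (l : 'I_s -> nat).
Hypothesis p_gt0 : forall t, (0 < p t)%N.
Hypothesis k_partition : is_partition n k.
Hypothesis h_bounds : forall j, (1 <= h j <= k j - 1)%N.
Hypothesis bezout : forall j, (\sum_(t | in_block k j t) a j t * lam j t =
  1 + \sum_(t | in_block k j t) b j t * lam j t)%N.
Hypothesis lam_p : forall j t, in_block k j t -> (lam j t * p t = l j)%N.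
Local Notation G := (@block_powers R n s k lam).
Local Notation f := (@block_coord R n s k a b).

(** Since lam_t = l_j / p_t on block j, the balance condition times l_j equates the exponents of u_j
    and of its conjugate. *)
Lemma block_powers_monomial nu mu tau :
  admissible p k h nu mu -> G tau -> monomial nu mu tau = 1.
Proof.
move=> [_ bal _ _] [u u1 tauu]; rewrite /monomial (big_blocks k_partition).
rewrite big1 // => j _; rewrite (prod_common_base _ _ (tauu j)).
suff -> : (\sum_(t | in_block k j t) mu t * lam j t =
           \sum_(t | in_block k j t) nu t * lam j t)%N.
  by rewrite -exprMn mulr_conj // expr1n.
apply/esym/eqP; rewrite -(eqr_nat rat) -subr_eq0 !natr_sum -sumrB.
apply/eqP; transitivity ((l j)%:R * 0 : rat); last exact: mulr0.
rewrite -[in RHS](bal j) big_distrr /=.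
apply: eq_bigr => t jt; rewrite !natrM -mulrBl -(lam_p jt) natrM.
by rewrite mulrACA divff ?pnatr_eq0 -?lt0n // mulr1 mulrC.
Qed.

Lemma block_powers_invariant : connected_invariance_subgroup p k h G.
Proof.
split; [exact: block_powers_subgroup|exact: block_powers_connected|].
move=> tau Gtau; apply: symbols_torus_invariant.
  exact: (block_powers_torus k_partition Gtau).
by move=> nu mu adm; exact: block_powers_monomial.
Qed.

Lemma connected_invariance_sub (H : set 'rV[R[i]]_n) :
  connected_invariance_subgroup p k h H -> H `<=` G.
Proof.
move=> [[HT H1 _ _] cH inv] x Hx.
apply/(block_powersP k_partition bezout); split; first exact: HT.
(* On the torus the conjugate is the inverse, so [q] is the ratio of y_t to f_j(y)^(lam_t). *)
move=> j t jt; pose q (y : 'rV[R[i]]_n) := y 0 t * (f y 0 j ^+ lam j t)^*.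
have fT y : H y -> `|f y 0 j| = 1 
  by move=> /HT yT; exact: (@block_coord_torus R n s k a b y yT j).
have qp y : H y -> q y ^+ p t = 1.
  move=> Hy; have [c [c1 yc]] :=
    common_power p_gt0 k_partition h_bounds (HT _ Hy) (inv _ Hy) j.
  (* On the block, y_t^(l_j) = (y_t^(p_t))^(lam_t) = c^(lam_t), so [f] recovers [c] from the tuple
     of l_j-th powers. *)
  have fl : f y 0 j ^+ l j = c.
    rewrite mxE -monomial_exprn.
    have := @block_coord_eq R n s k lam a b bezout (\row_t y 0 t ^+ l j) j c c1.
    rewrite mxE; apply=> t' jt'.
    by rewrite mxE -(lam_p jt') mulnC exprM yc.
  by rewrite /q exprMn (yc _ jt) -rmorphXn -exprM lam_p // fl mulr_conj.
have qc : continuous q.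
  apply: continuous_mulc; first exact: rV_coord_continuous.
  by apply: continuous_conj; exact: block_coord_entry_continuous.
have q1 : q x = 1.
  (* The image of [H] is connected, consists of p_t-th roots of unity and contains q(1) = 1. *)
  apply: (@connected_finite _ (q @` H)).
  - exact/connected_continuous_connected/continuous_subspaceT.
  - apply: sub_finite_set (finite_unity_root _ (p_gt0 t)).
    by move=> _ [y Hy <-] /=; exact: qp.
  - by exists x.
  - exists (const_mx 1) => //.
    have f1 : f (const_mx 1) 0 j = 1.
      apply: (block_coord_eq bezout); rewrite ?normr1 // => t' _.
      by rewrite mxE expr1n.
    by rewrite /q f1 mxE expr1n rmorph1 mulr1.
have F1 : `|f x 0 j ^+ lam j t| = 1 by rewrite normrX fT // expr1n.
by rewrite -[LHS]mulr1 -(mulr_conj F1) mulrCA [X in _ * X]q1 mulr1.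
Qed.

End invariance_group.

(** * The exponents of the homomorphism, reduced by block gcds *)

Lemma lcm_weights_gt0 n (p : 'I_n -> nat) :
  (forall t, (0 < p t)%N) -> (0 < lcm_weights p)%N.
Proof.
move=> p0; rewrite /lcm_weights; elim/big_ind: _ => // x y x0 y0.
by rewrite lcmn_gt0 x0.
Qed.

Lemma Lambda_mul n (p : 'I_n -> nat) t : (Lambda p t * p t)%N = lcm_weights p.
Proof. by rewrite /Lambda divnK // (biglcmn_sup t). Qed.

Definition block_gcd n s (p : 'I_n -> nat) (k : 'I_s -> nat) (j : 'I_s) : nat :=
  \big[gcdn/0]_(t | in_block k j t) Lambda p t.

Definition reduced_Lambda n s (p : 'I_n -> nat) (k : 'I_s -> nat) (j : 'I_s)
    (t : 'I_n) : nat :=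
  (Lambda p t %/ block_gcd p k j)%N.

Section reduced_exponents.
Variables (n s : nat) (p : 'I_n -> nat) (k : 'I_s -> nat).
Hypothesis p_gt0 : forall t, (0 < p t)%N.
Hypothesis k_partition : is_partition n k.

Lemma reduced_LambdaK j t : in_block k j t ->
  (reduced_Lambda p k j t * block_gcd p k j = Lambda p t)%N.
Proof. by move=> jt; rewrite divnK // /block_gcd (biggcdn_inf t). Qed.

(** An empty gcd would be 0; the first index of the block has a positive [Lambda] divisible by the
    gcd. *)
Lemma block_gcd_gt0 j : (0 < block_gcd p k j)%N.
Proof.
have kn : (khat k j + k j <= n)%N.
  by rewrite -khatS -[leqRHS](khat_total k_partition) leq_khat.
have kj : (0 < k j)%N by case: k_partition.
have tn : (khat k j < n)%N by lia.
have jt : in_block k j (Ordinal tn) by rewrite /in_block khatS /=; lia.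
have := lcm_weights_gt0 p_gt0.
rewrite -(Lambda_mul p (Ordinal tn)) -(reduced_LambdaK jt).
by rewrite !muln_gt0 => /andP[/andP[]].
Qed.

(** The value does not depend on [t] and supplies the [l j] of the invariance argument. *)
Lemma reduced_Lambda_mul j t : in_block k j t ->
  (reduced_Lambda p k j t * p t = lcm_weights p %/ block_gcd p k j)%N.
Proof.
move=> jt; rewrite -(Lambda_mul p t) -(reduced_LambdaK jt) mulnAC mulnK //.
exact: block_gcd_gt0.
Qed.

Lemma reduced_bezout : exists a b : 'I_s -> 'I_n -> nat, forall j,
  (\sum_(t | in_block k j t) a j t * reduced_Lambda p k j t =
   1 + \sum_(t | in_block k j t) b j t * reduced_Lambda p k j t)%N.
Proof.
have ex j : exists ab : ('I_n -> nat) * ('I_n -> nat),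
    (\sum_(t | in_block k j t) ab.1 t * reduced_Lambda p k j t =
     1 + \sum_(t | in_block k j t) ab.2 t * reduced_Lambda p k j t)%N.
  have := @bezout_biggcdn _ [seq t <- index_enum 'I_n | in_block k j t]
    (Lambda p) (filter_uniq _ (index_enum_uniq _)).
  rewrite !big_filter => -[a [b]]; rewrite !big_filter => ab.
  exists (a, b); apply/eqP.
  (* Multiplication by the positive block gcd turns the goal into the relation for [Lambda]. *)
  rewrite -(eqn_pmul2r (block_gcd_gt0 j)) mulnDl mul1n.
  rewrite !big_distrl /=; apply/eqP.
  have scale (c : 'I_n -> nat) :
      (\sum_(t | in_block k j t) c t * reduced_Lambda p k j t * block_gcd p k j
       = \sum_(t | in_block k j t) c t * Lambda p t)%N.
    by apply: eq_bigr => t jt; rewrite -mulnA reduced_LambdaK.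
  by rewrite !scale.
have [ab abP] := choice ex.
by exists (fun j => (ab j).1), (fun j => (ab j).2).
Qed.

(** Raising to the power of a positive block gcd maps the circle onto itself, so dividing it out of
    the exponents keeps the image. *)
Lemma torus_hom_block_torus (R : realType) :
  torus_hom p @` @block_torus R n s k =
  @block_powers R n s k (reduced_Lambda p k).
Proof.
apply/seteqP; split => x.
  case=> tau [tau1 [w w1 tauw]] <-.
  exists (\row_j w 0 j ^+ block_gcd p k j).
    by move=> j; rewrite mxE normrX w1 expr1n.
  by move=> j t jt; rewrite !mxE (tauw _ _ jt) -exprM mulnC reduced_LambdaK.
case=> u u1 xu; pose w : 'rV[R[i]]_s := \row_j (block_gcd p k j).-root (u 0 j).
have w1 : torus w.
  by move=> j; rewrite mxE norm_rootC u1 rootC1 // block_gcd_gt0.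
have tauw j t : in_block k j t ->
    (\row_t \prod_(i | in_block k i t) w 0 i : 'rV[R[i]]_n) 0 t = w 0 j.
  by move=> jt; rewrite mxE (big_in_block1 _ _ jt).
exists (\row_t \prod_(i | in_block k i t) w 0 i).
  split; last by exists w.
  by move=> t; have [j jt] := in_block_ex t k_partition; rewrite (tauw _ _ jt).
apply/rowP => t; have [j jt] := in_block_ex t k_partition.
rewrite mxE (tauw _ _ jt) (xu _ _ jt) -(reduced_LambdaK jt) mulnC exprM.
by rewrite mxE rootCK // block_gcd_gt0.
Qed.

End reduced_exponents.

Theorem theorem5p1 (R : realType) (n s : nat) (p : 'I_n -> nat)
    (k h : 'I_s -> nat)
    (p_gt0 : forall t, (0 < p t)%N)
    (k_partition : is_partition n k)
    (h_bounds : forall j, (1 <= h j <= k j - 1)%N) :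
  (exists G : set 'rV[R[i]]_n,
    is_maximal_connected_invariance_subgroup p k h G) /\
  (forall G : set 'rV[R[i]]_n,
    is_maximal_connected_invariance_subgroup p k h G ->
    [/\ G = torus_hom p @` @block_torus R n s k,
        closed G,
        torus_subgroup G &
        torus_group_isomorphic G (@torus R s)]).
Proof.
have [a [b bezout]] := reduced_bezout p_gt0 k_partition.
pose G := @block_powers R n s k (reduced_Lambda p k).
have Ginv : connected_invariance_subgroup p k h G.
  apply: block_powers_invariant => //; exact: reduced_Lambda_mul.
have Gmax H : connected_invariance_subgroup p k h H -> H `<=` G.
  apply: (connected_invariance_sub p_gt0 k_partition h_bounds bezout).
  exact: reduced_Lambda_mul.
split.
  exists G; split=> // H Hinv GH; apply/seteqP; split=> //; exact: Gmax.
(* [G] contains every connected invariance subgroup, so a maximal one must equal it. *)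
move=> H [Hinv Hmax]; have <- : G = H := Hmax _ Ginv (Gmax _ Hinv).
split.
- by rewrite torus_hom_block_torus.
- exact: (block_powers_closed k_partition bezout).
- exact: block_powers_subgroup.
- exact: (block_powers_isomorphic R k_partition bezout).
Qed.
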